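(* Let $\mathcal{H}$ be an infinite-dimensional, separable, complex Hilbert space. For all $j,k \in \{0,1,2,\ldots\}\cup\{\infty\}$, there exist a normal operator $D \in \mathcal{B}(\mathcal{H})$ and an orthogonal projection $P \in \mathcal{B}(\mathcal{H})$ for which \[ \mathrm{rank}\, (I-P) D P = j \quad\text{and}\quad \mathrm{rank}\, P D (I-P) = k. \]
   Context: $\mathcal{B}(\mathcal{H})$ denotes the bounded linear operators on $\mathcal{H}$. An orthogonal projection is $P$ with $P=P^2=P^*$. The rank of an operator is the dimension of its range, with value $\infty$ if the range is infinite-dimensional. *)

(* Defs.v *)
From HB Require Import structures.
From mathcomp Require Import all_boot all_order all_algebra.
From mathcomp Require Import sesquilinear.
From mathcomp Require Import all_classical all_reals all_analysis.
From mathcomp Require Export complex.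

Set Implicit Arguments.
Unset Strict Implicit.
Unset Printing Implicit Defensive.

Import Order.TTheory GRing.Theory Num.Theory Num.Def.
Import numFieldNormedType.Exports.

Local Open Scope classical_set_scope.
Local Open Scope ring_scope.

Section Dimension.
Context {K : fieldType} {V : lmodType K}.

Definition lin_comb n (e : 'I_n -> V) (c : 'I_n -> K) : V :=
  \sum_(i < n) c i *: e i.

Definition lin_indep n (e : 'I_n -> V) : Prop :=
  forall c : 'I_n -> K, lin_comb e c = 0 -> forall i, c i = 0.

Definition is_basis (W : set V) n (e : 'I_n -> V) : Prop :=
  lin_indep e /\ range (lin_comb e) = W.

Definition has_dim (W : set V) (n : nat) : Prop :=
  exists e : 'I_n -> V, is_basis W e.

(* Values in {0, 1, 2, ...} together with infinity: [Some n] is the finite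
   dimension n and [None] is infinity, taken when [W] has no finite basis. *)
Definition dimension (W : set V) : option nat :=
  xget None (Some @` has_dim W).

Lemma has_dim_leq (W : set V) m n : has_dim W m -> has_dim W n -> (m <= n)%N.
Proof.
move=> [e [eI eW]] [f [fI fW]].
have unit_comb p (g : 'I_p -> V) i : g i = lin_comb g (fun j => (i == j)%:R : K).
  rewrite /lin_comb (bigD1 i) //= eqxx scale1r big1 ?addr0 // => j.
  by rewrite eq_sym => /negPf ->; rewrite scale0r.
have mem_comb p q (g : 'I_p -> V) (h : 'I_q -> V) :
    range (lin_comb g) = range (lin_comb h) ->
    exists A : 'M[K]_(p, q), forall i, g i = lin_comb h (A i).
  move=> gh; have gP i : exists c, g i = lin_comb h c.
    have : range (lin_comb h) (g i).
      by rewrite -gh [g i]unit_comb; eexists.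
    by case=> c _ <-; exists c.
  have [c cP] := choice gP; exists (\matrix_(i, j) c i j) => i.
  by rewrite cP; apply: eq_bigr => j _; rewrite mxE.
have [A eA] : exists A : 'M[K]_(m, n), forall i, e i = lin_comb f (A i).
  by apply: mem_comb; rewrite eW fW.
have [B fB] : exists B : 'M[K]_(n, m), forall i, f i = lin_comb e (B i).
  by apply: mem_comb; rewrite eW fW.
apply: (@mulmx1_min _ _ _ A B); apply/matrixP => i k; apply/eqP.
rewrite -subr_eq0; apply/eqP.
apply: (eI (fun k => (A *m B) i k - (1%:M : 'M[K]_m) i k)).
rewrite /lin_comb; under eq_bigr do rewrite scalerBl.
rewrite sumrB; apply/eqP; rewrite subr_eq0; apply/eqP.
have -> : \sum_j (1%:M : 'M[K]_m) i j *: e j = e i.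
  by rewrite [RHS]unit_comb; apply: eq_bigr => j _; rewrite mxE.
rewrite [RHS]eA /lin_comb; under [RHS]eq_bigr do rewrite fB /lin_comb scaler_sumr.
rewrite exchange_big; apply: eq_bigr => j _ /=; rewrite mxE scaler_suml.
by apply: eq_bigr => l _; rewrite scalerA.
Qed.

Lemma dimension_Some (W : set V) n : dimension W = Some n <-> has_dim W n.
Proof.
rewrite /dimension; case: xgetP => [d -> [m Wm <-]|none]; split=> //.
- by case=> <-.
- move=> Wn; congr Some; apply/eqP.
  by rewrite eqn_leq !(has_dim_leq Wm Wn, has_dim_leq Wn Wm).
- by move=> Wn; case: (none (Some n)); exists n.
Qed.

Lemma dimension_None (W : set V) :
  dimension W = None <-> forall n, ~ has_dim W n.
Proof.
split=> [W0 n /dimension_Some|nW]; first by rewrite W0.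
by case E: (dimension W) => [n|//]; case: (nW n); apply/dimension_Some.
Qed.

End Dimension.

Definition separable (T : topologicalType) : Prop :=
  exists2 S : set T, countable S & dense S.

Section Operators.
Context {R : realType} {H : completeNormedModType R[i]}.

Definition bounded_operator (T : {linear H -> H}) : Prop :=
  exists M : R[i], forall x : H, `|T x| <= M * `|x|.

Definition rank (T : H -> H) : option nat := dimension (range T).

(* Linear in the first argument, conjugate-linear in the second. *)
Variable dot : {dot H for conjC}.

Definition is_adjoint (T S : H -> H) : Prop :=
  forall x y : H, dot (T x) y = dot x (S y).

Lemma is_adjoint_unique (T S1 S2 : H -> H) :
  is_adjoint T S1 -> is_adjoint T S2 -> S1 = S2.
Proof.
move=> a1 a2; apply/funext => y; apply/eqP; rewrite -subr_eq0.
have [//|/(neq0_dnorm_gt0 (s := dot))] := boolP (S1 y - S2 y == 0).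
by rewrite (raddfB (dot _)) /= -a1 -a2 subrr ltxx.
Qed.

(* [S] is the adjoint of [T], by [is_adjoint_unique]. *)
Definition normal_operator (T : {linear H -> H}) : Prop :=
  bounded_operator T /\
  exists S : {linear H -> H},
    [/\ bounded_operator S, is_adjoint T S & T \o S =1 S \o T].

Definition orthogonal_projection (P : {linear H -> H}) : Prop :=
  [/\ bounded_operator P, P \o P =1 P & is_adjoint P P].

End Operators.

(* Main.v *)
From HB Require Import structures.
Require Import Defs.
From mathcomp Require Import all_boot all_order all_algebra.
From mathcomp Require Import sesquilinear.
From mathcomp Require Import all_classical all_reals all_analysis.
From mathcomp Require Import zify.
Import Order.TTheory GRing.Theory Num.Theory.
Import numFieldNormedType.Exports.
Local Open Scope classical_set_scope.
Local Open Scope ring_scope.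

(** Take an orthonormal family [u] in [H] indexed by countably many copies of
    the integers (the strands), and let [D] be the bilateral shift by one along
    every strand, extended by zero to the orthogonal complement of the family.
    Then [D] maps the [u i] bijectively onto themselves, so [D D*] and [D* D]
    are both the projection onto the closed span of [u], and [D] is normal.

    Let [P] project onto the closed span of the [u i] for [i] in a set [A] of
    indices.  Then [(I - P) D P] and [P D (I - P)] are partial isometries whose
    ranks count the steps of the shift that leave [A] and that enter [A].  If
    [A] is a negative half line on [j] strands, a nonnegative half line on [k]
    further strands, and empty on all others, exactly [j] steps leave and [k]
    steps enter.  No finite-dimensional normal matrix can separate [j = 0] from
    [k > 0], since its two off-diagonal corners have the same Frobenius norm;
    this is why infinite strands are used.

    All operators involved have the form [x |-> sum_n <x, a n> b n] for
    sequences [a], [b] of pairwise orthogonal vectors of norm at most 1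
    (lemmas [expands_exists], [expands_bounded]); exchanging [a] and [b] gives
    the adjoint ([expands_adjoint]).  Zero entries are allowed, so partial
    isometries and projections are covered.  Operator identities and ranks are then read off from the
    values on the [u i] alone, through [adjoint_vanishes_off_images]: if [T]
    vanishes on the complement of [u], the adjoint of [T] vanishes on
    every vector orthogonal to all the [T (u i)]. *)

(** * Bessel's inequality and the Cauchy-Schwarz inequality *)

Section HilbertSpace.
Variables (R : realType) (H : completeNormedModType R[i]).
Variable dot : {dot H for Num.conj}.
Hypothesis dot_norm : forall x : H, `|x| ^+ 2 = dot x x.

Lemma dotC x y : dot x y = (dot y x)^*.
Proof. by have /= := hermC dot x y; rewrite expr0 mul1r. Qed.

Lemma dot_eq0C x y : dot x y = 0 -> dot y x = 0.
Proof. by move=> xy; rewrite dotC xy rmorph0. Qed.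

Lemma dotxx_eq0 x : dot x x = 0 -> x = 0.
Proof. by move/eqP; rewrite dnorm_eq0 => /eqP. Qed.

Lemma dot_suml (I : Type) (r : seq I) (F : I -> H) y :
  dot (\sum_(i <- r) F i) y = \sum_(i <- r) dot (F i) y.
Proof.
apply: (big_morph (dot^~ y)) => [u v|]; first exact: linearDl.
exact: linear0l.
Qed.

Lemma dot_sumr (I : Type) (r : seq I) (F : I -> H) y :
  dot y (\sum_(i <- r) F i) = \sum_(i <- r) dot y (F i).
Proof. exact: raddf_sum. Qed.

(** Norms at most 1, zero included, so that a subfamily of an orthonormal
    sequence can be encoded by replacing the other terms by zero. *)
Definition suborthonormal (a : nat -> H) : Prop :=
  (forall m n, m != n -> dot (a m) (a n) = 0) /\
  (forall n, dot (a n) (a n) <= 1).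

Lemma dot_suborthonormal_sum (a : nat -> H) (c : nat -> R[i]) (r : seq nat) :
  suborthonormal a -> uniq r ->
  dot (\sum_(n <- r) c n *: a n) (\sum_(n <- r) c n *: a n) =
  \sum_(n <- r) `|c n| ^+ 2 * dot (a n) (a n).
Proof.
move=> [a0 _] r_uniq; rewrite dot_suml; apply: eq_big_seq => n rn.
rewrite dot_sumr (bigD1_seq n) //= big1 ?addr0 => [|m mn].
  by rewrite linearZl_LR linearZr_LR /= mulrA normCK.
by rewrite linearZl_LR linearZr_LR /= (a0 n m) ?mulr0 // eq_sym.
Qed.

Lemma suborthonormal_sum_le (a : nat -> H) (c : nat -> R[i]) (r : seq nat) :
  suborthonormal a -> uniq r ->
  `|\sum_(n <- r) c n *: a n| ^+ 2 <= \sum_(n <- r) `|c n| ^+ 2.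
Proof.
move=> sa r_uniq; rewrite dot_norm dot_suborthonormal_sum //.
apply: ler_sum => n _; apply: ler_piMr; first by rewrite exprn_ge0.
by case: sa.
Qed.

(** With [y] the sum of the [<x, a n> a n] and [S] the left-hand side,
    [<y, y> <= S = <x, y>], so [0 <= <x - y, x - y> <= <x, x> - S]. *)
Lemma bessel (a : nat -> H) x (r : seq nat) : suborthonormal a -> uniq r ->
  \sum_(n <- r) `|dot x (a n)| ^+ 2 <= `|x| ^+ 2.
Proof.
move=> sa r_uniq; set S := \sum_(n <- r) _.
pose y := \sum_(n <- r) dot x (a n) *: a n.
have yS : dot y y <= S by rewrite -dot_norm; exact: suborthonormal_sum_le.
have xy : dot x y = S.
  rewrite dot_sumr; apply: eq_bigr => n _.
  by rewrite linearZr_LR /= normCK mulrC.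
have S_ge0 : 0 <= S by apply: sumr_ge0 => n _; rewrite exprn_ge0.
have := dnorm_ge0 dot (x - y); rewrite dnormB /= xy.
rewrite (CrealP (ger0_real S_ge0)) -dot_norm => h.
rewrite -subr_ge0; apply: le_trans h _.
by rewrite opprD addrA lerD2r -addrA gerDl subr_le0.
Qed.

(** Bessel's inequality for the single vector [y / |y|]. *)
Lemma cauchy_schwarz x y : `|dot x y| <= `|x| * `|y|.
Proof.
have [->|y0] := eqVneq y 0; first by rewrite raddf0 !normr0 mulr0.
have ny : 0 < `|y| by rewrite normr_gt0.
pose a n : H := if n == 0%N then `|y|^-1 *: y else 0.
have sa : suborthonormal a.
  split=> [[|m] [|n] //= _|[|n]]; rewrite /a /= ?raddf0 ?linear0l ?ler01 //.
  by rewrite -dot_norm normrZ normfV normr_id mulVf ?expr1n // gt_eqF.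
have := @bessel a x [:: 0%N] sa isT.
rewrite big_seq1 /a /= linearZr_LR /= normrM.
rewrite ler_pXn2r ?nnegrE ?mulr_ge0 // norm_conjC normfV normr_id.
by rewrite mulrC ler_pdivrMr.
Qed.

(** The squared norm of a block of the series is at most the same block of
    [sum |<x, a n>|^2], a real series with nonnegative terms that is bounded
    by Bessel's inequality; completeness of [H] concludes. *)
Lemma suborthonormal_series_cvg (a b : nat -> H) x :
  suborthonormal a -> suborthonormal b ->
  cvg (series (fun n => dot x (a n) *: b n) @ \oo).
Proof.
move=> sa sb; apply/cauchy_cvgP/cauchy_seriesP => e e0.
pose v n : R := complex.Re (`|dot x (a n)| ^+ 2).
have vE n : (v n)%:C%C = `|dot x (a n)| ^+ 2.
  by rewrite /v RRe_real // ger0_real // exprn_ge0.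
have v_ge0 n : 0 <= v n by rewrite -lecR vE exprn_ge0.
have vsum (r : seq nat) :
    (\sum_(n <- r) v n)%:C%C = \sum_(n <- r) `|dot x (a n)| ^+ 2.
  by rewrite rmorph_sum; apply: eq_bigr => n _; rewrite /= vE.
have vcvg : cvgn (series v).
  apply: nondecreasing_is_cvgn.
    by apply/nondecreasing_seqP => n; rewrite /series /= big_nat_recr //= lerDl.
  exists (complex.Re (`|x| ^+ 2)) => _ [N _ <-].
  rewrite -lecR vsum RRe_real ?ger0_real ?exprn_ge0 //.
  by apply: bessel => //; exact: iota_uniq.
have eE : (complex.Re e)%:C%C = e by rewrite RRe_real // ger0_real // ltW.
have re0 : 0 < complex.Re e by rewrite -ltcR eE.
have /cauchy_cvgP/(@cauchy_seriesP _ R^o)/(_ (complex.Re e ^+ 2)) := vcvg.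
rewrite exprn_gt0 // => /(_ isT); apply: filterS => -[m n] /= vmn.
rewrite -(@ltr_pXn2r _ 2) ?nnegrE ?normr_ge0 ?(ltW e0) //.
apply: le_lt_trans (suborthonormal_sum_le _ _ _ sb (iota_uniq _ _)) _.
rewrite -vsum -eE -rmorphXn /= ltcR; apply: le_lt_trans vmn.
exact: ler_norm.
Qed.


(** * Operators given by orthogonal expansions *)

Definition expands (T : H -> H) (a b : nat -> H) : Prop :=
  forall x, series (fun n => dot x (a n) *: b n) @ \oo --> T x.

Lemma expands_exists (a b : nat -> H) : suborthonormal a -> suborthonormal b ->
  exists T : {linear H -> H}, expands T a b.
Proof.
move=> sa sb; pose f x := lim (series (fun n => dot x (a n) *: b n) @ \oo).
have fP : expands f a b by move=> x; exact: suborthonormal_series_cvg.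
have f_linear : linear f.
  move=> k x y; apply: (cvg_unique (@norm_hausdorff _ _) (fP _)).
  have -> : series (fun n => dot (k *: x + y) (a n) *: b n) =
      (fun N => k *: series (fun n => dot x (a n) *: b n) N
                + series (fun n => dot y (a n) *: b n) N).
    apply/funext => N; rewrite /series /= scaler_sumr -big_split /=.
    by apply: eq_bigr => n _; rewrite linearPl /= scalerDl scalerA.
  by apply: cvgD (fP y); apply: cvgZr; exact: fP.
pose F : {linear H -> H} :=
  HB.pack f (@GRing.isLinear.Build _ _ _ _ f f_linear).
by exists F.
Qed.

(** The partial sums have norm at most [|x|]; the constant 2 leaves room for
    the distance from [T x] to a partial sum. *)
Lemma expands_bounded (a b : nat -> H) (T : {linear H -> H}) :
  suborthonormal a -> suborthonormal b -> expands T a b -> bounded_operator T.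
Proof.
move=> sa sb TP; exists 2 => x.
have [->|x0] := eqVneq x 0; first by rewrite raddf0 normr0 mulr0.
have nx : 0 < `|x| by rewrite normr_gt0.
have /cvgrPdist_lt/(_ _ nx) [N _ /(_ N (leqnn N)) /= TN] := TP x.
rewrite -[T x](subrK (series (fun n => dot x (a n) *: b n) N)).
rewrite (le_trans (ler_normD _ _)) // mulr_natl mulr2n lerD ?(ltW TN) //.
rewrite -(@ler_pXn2r _ 2) ?nnegrE //.
apply: le_trans (suborthonormal_sum_le _ _ _ sb (iota_uniq _ _)) _.
exact: bessel (iota_uniq _ _).
Qed.

(** The partial sums [s] of [T x] and [s'] of [S y] satisfy
    [<s, y> = <x, s'>] term by term, and the form is continuous in each
    argument. *)
Lemma expands_adjoint (a b : nat -> H) (T S : H -> H) :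
  expands T a b -> expands S b a -> is_adjoint dot T S.
Proof.
move=> TP SP x y; apply/eqP; rewrite -subr_eq0; set d := _ - _.
apply/negPn/negP => d0; have nd : 0 < `|d| by rewrite normr_gt0.
have c0 : 0 < 1 + `|x| + `|y| by rewrite -addrA ltr_pwDl // addr_ge0.
pose e := `|d| / (1 + `|x| + `|y|); have e0 : 0 < e by rewrite divr_gt0.
have /cvgrPdist_lt/(_ _ e0) [N1 _ TN] := TP x.
have /cvgrPdist_lt/(_ _ e0) [N2 _ SN] := SP y.
have /= {}TN := TN _ (leq_maxl N1 N2); have /= {}SN := SN _ (leq_maxr N1 N2).
move: TN SN; set N := maxn N1 N2.
set s := series _ N; set s' := series _ N => TN SN.
have ss' : dot s y = dot x s'.
  rewrite dot_suml dot_sumr; apply: eq_bigr => n _.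
  by rewrite linearZl_LR linearZr_LR /= -dotC mulrC.
have dE : d = dot (T x - s) y - dot x (S y - s').
  by rewrite linearBl raddfB /= ss' opprB addrA subrK.
suff : `|d| < e * (1 + `|x| + `|y|) by rewrite mulfVK ?ltxx // gt_eqF.
rewrite [in ltLHS]dE (le_lt_trans (ler_normB _ _)) // -addrA mulrDr mulr1.
rewrite ltr_pwDl // mulrDr addrC lerD // (le_trans (cauchy_schwarz _ _)) //.
  by rewrite mulrC ler_wpM2r // ltW.
by rewrite ler_wpM2r // ltW.
Qed.

Lemma expands_single (a b : nat -> H) (T : H -> H) z n0 : expands T a b ->
  (forall n, n != n0 -> dot z (a n) = 0) -> T z = dot z (a n0) *: b n0.
Proof.
move=> TP zn; apply: (cvg_unique (@norm_hausdorff _ _) (TP z)).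
apply: cvg_near_cst; exists n0.+1 => // N /= n0N.
rewrite /series /= (bigD1_seq n0) ?iota_uniq ?mem_index_iota //=.
by rewrite big1 ?addr0 // => n /zn ->; rewrite scale0r.
Qed.

(** * Operators determined on a family of vectors *)

Section DeterminedOnFamily.
Variables (I : Type) (u : I -> H).

(** The vector [S w] is orthogonal to every [u i], because
    [<S w, u i> = <w, T (u i)>]; hence [T (S w) = 0], and
    [<S w, S w> = <T (S w), w> = 0]. *)
Lemma adjoint_vanishes_off_images (T S : {linear H -> H}) w :
  is_adjoint dot T S ->
  (forall z, (forall i, dot z (u i) = 0) -> T z = 0) ->
  (forall i, dot w (T (u i)) = 0) -> S w = 0.
Proof.
move=> TS Tker wT; apply: dotxx_eq0; rewrite -TS Tker ?linear0l // => i.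
by apply: dot_eq0C; rewrite -TS; exact: dot_eq0C.
Qed.

(** Applied to the differences [P P - P] and [D D* - D* D], this reduces
    idempotence and normality to a computation on the [u i]. *)
Lemma selfadjoint_eq0 (T : {linear H -> H}) : is_adjoint dot T T ->
  (forall z, (forall i, dot z (u i) = 0) -> T z = 0) ->
  (forall i, T (u i) = 0) -> forall x, T x = 0.
Proof.
move=> TT Tker Tu x; apply: adjoint_vanishes_off_images TT Tker _ => i.
by rewrite Tu raddf0.
Qed.

End DeterminedOnFamily.

(** * Orthonormal families and rank *)

Lemma orthonormal_lin_indep n (e : 'I_n -> H) :
  (forall i j, dot (e i) (e j) = (i == j)%:R) -> lin_indep e.
Proof.
move=> e_on c c0 i; have := congr1 (dot^~ (e i)) c0.
rewrite linear0l dot_suml (bigD1 i) //= big1 ?addr0 => [|l li].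
  by rewrite linearZl_LR /= e_on eqxx /= mulr1.
by rewrite linearZl_LR /= e_on (negPf li) /= mulr0.
Qed.

Lemma orthonormal_residual n (e : 'I_n -> H) x i :
  (forall i j, dot (e i) (e j) = (i == j)%:R) ->
  dot (x - lin_comb e (fun l => dot x (e l))) (e i) = 0.
Proof.
move=> e_on; rewrite linearBl /= dot_suml (bigD1 i) //= big1 => [|l li].
  by rewrite linearZl_LR /= e_on eqxx mulr1 addr0 subrr.
by rewrite linearZl_LR /= e_on (negPf li) mulr0.
Qed.

(** Writing [e i] as the sum of the [c i l *: f l] over a basis [f] of [W],
    the Gram matrix of [e] factors as [1 = C *m G] through dimension [n]. *)
Lemma has_dim_orthonormal_leq (W : set H) n m (e : nat -> H) :
  (forall i j, dot (e i) (e j) = (i == j)%:R) ->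
  (forall i, (i < m)%N -> W (e i)) -> has_dim W n -> (m <= n)%N.
Proof.
move=> e_on eW [f [_ fW]].
have /choice [c cP] : forall i : 'I_m, exists c, lin_comb f c = e i.
  by move=> i; have := eW i (ltn_ord i); rewrite -fW => -[c _ cE]; exists c.
apply: (@mulmx1_min _ _ _
  (\matrix_(i, l) c i l) (\matrix_(l, j) dot (f l) (e j))).
apply/matrixP => i j; rewrite !mxE -(e_on i j) -cP dot_suml.
by apply: eq_bigr => l _; rewrite !mxE linearZl_LR.
Qed.

Definition below (j : option nat) m : bool :=
  if j is Some n then (m < n)%N else true.

(** The last hypothesis bounds the rank from above: if [w] is the component of
    [T x] orthogonal to the [h m], then [<T x, w> = <x, S w> = 0], so that
    [w = 0] and [T x] lies in the span of the [h m]. *)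
Lemma rank_orthonormal (T S : {linear H -> H}) (j : option nat) (h : nat -> H) :
  is_adjoint dot T S ->
  (forall m n, dot (h m) (h n) = (m == n)%:R) ->
  (forall m, below j m -> range T (h m)) ->
  (forall w, (forall m, below j m -> dot w (h m) = 0) -> S w = 0) ->
  rank T = j.
Proof.
move=> TS h_on hT Sker; case: j hT Sker => [n|] /= hT Sker; last first.
  apply/dimension_None => n /(has_dim_orthonormal_leq _ _ n.+1 _ h_on).
  by rewrite ltnn => /(_ (fun i _ => hT i isT)).
pose e (i : 'I_n) := h i.
have e_on i l : dot (e i) (e l) = (i == l)%:R by rewrite h_on.
apply/dimension_Some; exists e; split; first exact: orthonormal_lin_indep.
apply/seteqP; split => [_ [c _ <-]|_ [x _ <-]].
  have /choice [g gP] : forall i : 'I_n, exists x, T x = h i.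
    by move=> i; have [x _ xE] := hT i (ltn_ord i); exists x.
  exists (\sum_(i < n) c i *: g i) => //.
  by rewrite linear_sum; apply: eq_bigr => i _; rewrite linearZ_LR gP.
exists (fun i => dot (T x) (e i)) => //.
set y := lin_comb _ _; apply/esym/eqP; rewrite -subr_eq0; apply/eqP.
have yh m : (m < n)%N -> dot (T x - y) (h m) = 0.
  by move=> mn; exact: (orthonormal_residual _ e _ (Ordinal mn)).
apply: dotxx_eq0; rewrite [in X in dot X _]/= linearBl /= TS Sker // raddf0 sub0r.
rewrite dot_suml big1 ?oppr0 // => i _.
by rewrite linearZl_LR /= (@dot_eq0C _ (h i)) ?mulr0 // yh.
Qed.

(** The form in which both corners are treated: [B] holds the indices at which
    the shift crosses the boundary, and the vectors reached there are exactly
    the terms of [h] with index below [j]. *)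
Lemma rank_partial_isometry (I : Type) (u v : I -> H) (T S : {linear H -> H})
    (B : pred I) (j : option nat) (h : nat -> H) :
  is_adjoint dot T S ->
  (forall m n, dot (h m) (h n) = (m == n)%:R) ->
  (forall z, (forall i, dot z (u i) = 0) -> T z = 0) ->
  (forall i, T (u i) = if B i then v i else 0) ->
  (forall m, below j m -> exists2 i, B i & v i = h m) ->
  (forall i, B i -> exists2 m, below j m & v i = h m) ->
  rank T = j.
Proof.
move=> TS h_on Tker Tu hB Bh; apply: (rank_orthonormal _ _ _ _ TS h_on).
  by move=> m /hB[i Bi <-]; exists (u i) => //; rewrite Tu Bi.
move=> w wh; apply: (adjoint_vanishes_off_images _ u _ _ _ TS Tker) => i.
rewrite Tu; case: ifPn => [/Bh[m jm ->]|_]; first exact: wh.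
exact: raddf0.
Qed.

(** * An infinite orthonormal sequence *)

Definition orthonormal_seq (s : seq H) : Prop := forall m n,
  (m < size s)%N -> (n < size s)%N -> dot s`_m s`_n = (m == n)%:R.

(** A Gram-Schmidt step: since [H] is infinite-dimensional, some [x] differs
    from its projection to the span of [s], and the normalized difference can
    be appended. *)
Lemma orthonormal_extend (s : seq H) : dimension [set: H] = None ->
  orthonormal_seq s -> exists v, orthonormal_seq (rcons s v).
Proof.
move=> /dimension_None/(_ (size s)) Hinf s_on.
pose e (i : 'I_(size s)) := s`_i.
have e_on i j : dot (e i) (e j) = (i == j)%:R by rewrite s_on.
pose p x := lin_comb e (fun i => dot x (e i)).
have pe x i : dot (x - p x) (e i) = 0 by exact: orthonormal_residual.
have [x xp] : exists x, x != p x.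
  apply/not_existsP => allp; apply: Hinf; exists e; split.
    exact: orthonormal_lin_indep.
  apply/seteqP; split => // x _; exists (fun i => dot x (e i)) => //.
  by apply/esym/eqP/negPn/negP; exact: allp.
pose y := x - p x; have ny : `|y| != 0 by rewrite normr_eq0 subr_eq0.
pose v := `|y|^-1 *: y; exists v.
have vs n : (n < size s)%N -> dot v s`_n = 0.
  by move=> ns; rewrite linearZl_LR /= (pe x (Ordinal ns)) mulr0.
have vv : dot v v = 1.
  by rewrite -dot_norm normrZ normfV normr_id mulVf ?expr1n.
move=> m n; rewrite size_rcons !ltnS !nth_rcons => ms ns.
have [mlt|mge] := ltnP m (size s); have [nlt|nge] := ltnP n (size s).
- exact: s_on.
- have -> : n = size s by apply/eqP; rewrite eqn_leq ns.
  by rewrite eqxx (dot_eq0C _ _ (vs _ mlt)) ltn_eqF.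
- have -> : m = size s by apply/eqP; rewrite eqn_leq ms.
  by rewrite eqxx vs // gtn_eqF.
- have -> : m = size s by apply/eqP; rewrite eqn_leq ms.
  have -> : n = size s by apply/eqP; rewrite eqn_leq ns.
  by rewrite eqxx vv.
Qed.

Lemma orthonormal_sequence_exists : dimension [set: H] = None ->
  exists e : nat -> H, forall m n, dot (e m) (e n) = (m == n)%:R.
Proof.
move=> Hinf.
have /choice [f fP] : forall s, exists v,
    orthonormal_seq s -> orthonormal_seq (rcons s v).
  move=> s; have [s_on|//] := pselect (orthonormal_seq s).
    have [v sv] := orthonormal_extend _ Hinf s_on.
    by exists v.
  by exists 0.
pose s n := iter n (fun s => rcons s (f s)) [::].
have s_on n : orthonormal_seq (s n) by elim: n => [|n /fP].
have s_size n : size (s n) = n by elim: n => //= n; rewrite size_rcons => ->.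
have s_nth n m : (m < n)%N -> (s n)`_m = f (s m).
  elim: n => // n IHn; rewrite ltnS /= nth_rcons s_size.
  by case: ltngtP => // [/IHn|->].
exists (fun n => f (s n)) => m n; pose N := (maxn m n).+1.
have mN : (m < N)%N by rewrite ltnS leq_maxl.
have nN : (n < N)%N by rewrite ltnS leq_maxr.
by rewrite -(s_nth N m) // -(s_nth N n) // s_on ?s_size.
Qed.

(** * Projections and shifts for a countable orthonormal family *)

Section CountableFamily.
Variables (I : countType) (u : I -> H).
Hypothesis u_on : forall i j, dot (u i) (u j) = (i == j)%:R.

Definition zero_extend (a : I -> H) (n : nat) : H := oapp a 0 (pickle_inv n).

Lemma suborthonormal_zero_extend (a : I -> H) :
  (forall i j, i != j -> dot (a i) (a j) = 0) ->
  (forall i, dot (a i) (a i) <= 1) -> suborthonormal (zero_extend a).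
Proof.
move=> a0 a1; split=> [m n|n]; rewrite /zero_extend; last first.
  by case: pickle_inv => [i|] //=; rewrite raddf0 ler01.
have := pickle_invK (T := I) m; have := pickle_invK (T := I) n.
case: pickle_inv => [i|] /= nE; case: pickle_inv => [l|] /= mE mn;
  rewrite ?raddf0 ?linear0l //.
by apply: a0; apply: contraNneq mn => li; rewrite -nE -mE li.
Qed.

Lemma zero_extend_single (a b : I -> H) (T : H -> H) z i0 :
  expands T (zero_extend a) (zero_extend b) ->
  (forall i, i != i0 -> dot z (a i) = 0) -> T z = dot z (a i0) *: b i0.
Proof.
move=> TP zi; rewrite (expands_single _ _ _ z (pickle i0) TP) => [|n n0].
  by rewrite /zero_extend pickleK_inv.
rewrite /zero_extend; have := pickle_invK (T := I) n.
case: pickle_inv => [i|] /= nE; last by rewrite raddf0.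
by apply: zi; apply: contraNneq n0 => <-; rewrite nE.
Qed.

Lemma zero_extend_eq0 (a b : I -> H) (T : H -> H) z :
  expands T (zero_extend a) (zero_extend b) ->
  (forall i, dot z (a i) = 0) -> T z = 0.
Proof.
move=> TP za; have za0 n : dot z (zero_extend a n) = 0.
  by rewrite /zero_extend; case: pickle_inv => [i|] //=; rewrite raddf0.
by rewrite (expands_single _ _ _ z 0 TP) // za0 scale0r.
Qed.

(** Expand along the [u i] with [A i], padded by zeros, on both sides. *)
Lemma diagonal_projection_exists (A : pred I) :
  exists P : {linear H -> H}, [/\ orthogonal_projection dot P,
    forall z, (forall i, dot z (u i) = 0) -> P z = 0 &
    forall i, P (u i) = if A i then u i else 0].
Proof.
pose a i := if A i then u i else 0.
have sa : suborthonormal (zero_extend a).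
  apply: suborthonormal_zero_extend => [i l il|i]; rewrite /a.
    by do 2!case: ifP => _; rewrite ?raddf0 ?linear0l // u_on (negPf il).
  by case: ifP => _; rewrite ?u_on ?eqxx // raddf0 ler01.
have [P PP] := expands_exists _ _ sa sa.
have Padj : is_adjoint dot P P := expands_adjoint _ _ _ _ PP PP.
have Pu i : P (u i) = a i.
  rewrite (zero_extend_single _ _ _ _ i PP) => [|l li]; rewrite /a; case: ifP.
  - by rewrite u_on eqxx scale1r.
  - by rewrite scaler0.
  - by rewrite u_on eq_sym (negPf li).
  - by rewrite raddf0.
have Pker z : (forall i, dot z (u i) = 0) -> P z = 0.
  move=> zu; apply: (zero_extend_eq0 _ _ _ _ PP) => i.
  by rewrite /a; case: ifP; rewrite ?raddf0.
exists P; split=> //; split=> //; first exact: (expands_bounded _ _ _ sa sa PP).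
pose N : {linear H -> H} := (P \o P) \- P.
have NN : is_adjoint dot N N.
  by move=> x y; rewrite /= linearBl raddfB /= !Padj.
have N0 : forall x, N x = 0.
  apply: (selfadjoint_eq0 _ u _ NN) => [z zu|i] /=.
    by rewrite (Pker z) // raddf0 subrr.
  by rewrite Pu /a; case: ifP => Ai; rewrite ?Pu /a ?Ai ?(raddf0 P) subrr.
by move=> x; apply/eqP; rewrite -subr_eq0; apply/eqP; exact: N0.
Qed.

(** The adjoint of [D] shifts by [t], so the products of [D] and its adjoint in
    either order fix every [u i] and vanish on the complement; so they agree. *)
Lemma permutation_normal_exists (s t : I -> I) : cancel s t -> cancel t s ->
  exists D : {linear H -> H}, [/\ normal_operator dot D,
    forall z, (forall i, dot z (u i) = 0) -> D z = 0 &
    forall i, D (u i) = u (s i)].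
Proof.
move=> sK tK; have s_inj := can_inj sK.
have su : suborthonormal (zero_extend u).
  apply: suborthonormal_zero_extend => [i l il|i]; rewrite u_on ?eqxx //.
  by rewrite (negPf il).
have sus : suborthonormal (zero_extend (u \o s)).
  apply: suborthonormal_zero_extend => [i l il|i]; rewrite u_on ?eqxx //.
  by rewrite (inj_eq s_inj) (negPf il).
have [D DP] := expands_exists _ _ su sus.
have [S SP] := expands_exists _ _ sus su.
have DS : is_adjoint dot D S := expands_adjoint _ _ _ _ DP SP.
have SD : is_adjoint dot S D := expands_adjoint _ _ _ _ SP DP.
have Du i : D (u i) = u (s i).
  rewrite (zero_extend_single _ _ _ _ i DP) => [|l li]; rewrite u_on.
    by rewrite eqxx scale1r.
  by rewrite eq_sym (negPf li).
have Su i : S (u i) = u (t i).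
  rewrite (zero_extend_single _ _ _ _ (t i) SP) => [|l li]; rewrite /= u_on.
    by rewrite tK eqxx scale1r.
  by rewrite eq_sym -(can_eq tK) sK (negPf li).
have Dker z : (forall i, dot z (u i) = 0) -> D z = 0.
  exact: (zero_extend_eq0 _ _ _ _ DP).
have Sker z : (forall i, dot z (u i) = 0) -> S z = 0.
  by move=> zu; apply: (zero_extend_eq0 _ _ _ _ SP) => i; exact: zu.
exists D; split=> //; split; first exact: (expands_bounded _ _ _ su sus DP).
exists S; split=> //; first exact: (expands_bounded _ _ _ sus su SP).
pose N : {linear H -> H} := (D \o S) \- (S \o D).
have NN : is_adjoint dot N N.
  by move=> x y; rewrite /= linearBl raddfB /= !DS !SD !DS.
have N0 : forall x, N x = 0.
  apply: (selfadjoint_eq0 _ u _ NN) => [z zu|i] /=.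
    by rewrite (Dker z) // (Sker z) // (raddf0 D) (raddf0 S) subrr.
  by rewrite Su !Du Su tK sK subrr.
by move=> x; apply/eqP; rewrite -subr_eq0; apply/eqP; exact: N0.
Qed.

End CountableFamily.

End HilbertSpace.

(** * The strands *)

(** A strand is a pair [(b, m)].  The shift leaves the region on the strands
    [(true, m)] with [m] below [j], and enters it on the strands [(false, m)]
    with [m] below [k], in each case in the step from [-1] to [0]. *)
Definition strand_region (j k : option nat) (i : bool * nat * int) : bool :=
  let: (b, m, z) := i in
  if b then (z < 0) && below j m else (0 <= z) && below k m.

Definition strand_shift (d : int) (i : bool * nat * int) : bool * nat * int :=
  (i.1, i.2 + d).

Lemma strand_shiftK d : cancel (strand_shift d) (strand_shift (- d)).
Proof. by case=> i z; rewrite /strand_shift /= addrK. Qed.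

Lemma strand_shiftNK d : cancel (strand_shift (- d)) (strand_shift d).
Proof. by case=> i z; rewrite /strand_shift /= subrK. Qed.

Theorem theorem3p2 (R : realType) (H : completeNormedModType R[i])
    (dot : {dot H for Num.conj})
    (dot_norm : forall x : H, `|x| ^+ 2 = dot x x)
    (H_infdim : dimension [set: H] = None)
    (H_separable : separable H)
    (j k : option nat) :
  exists D P : {linear H -> H},
    [/\ normal_operator dot D,
        orthogonal_projection dot P,
        rank ((idfun \- P) \o D \o P) = j &
        rank (P \o D \o (idfun \- P)) = k].
Proof.
have [e e_on] := orthonormal_sequence_exists _ _ _ dot_norm H_infdim.
pose u (i : bool * nat * int) := e (pickle i).
have u_on i l : dot (u i) (u l) = (i == l)%:R.
  by rewrite e_on (inj_eq (pcan_inj pickleK)).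
pose s := strand_shift 1.
pose A := strand_region j k.
have [D [D_normal Dker Du]] :=
  permutation_normal_exists _ _ _ dot_norm _ _ u_on _ _
    (strand_shiftK 1) (strand_shiftNK 1).
have [P [P_proj Pker Pu]] := diagonal_projection_exists _ _ _ dot_norm _ _ u_on A.
exists D, P; split=> //.
- have [_ [S [_ DS _]]] := D_normal; have [_ _ PP] := P_proj.
  pose T : {linear H -> H} := (idfun \- P) \o D \o P.
  pose T' : {linear H -> H} := P \o S \o (idfun \- P).
  apply: (rank_partial_isometry _ _ dot _ u (u \o s) T T'
    (fun i => A i && ~~ A (s i)) j (fun m => u (true, m, 0))).
  + by move=> x y; rewrite /= linearBl /= !(PP, DS) !raddfB.
  + by move=> m n; rewrite u_on !xpair_eqE eqxx andbT.
  + by move=> z zu; rewrite /= (Pker z) // (raddf0 D) (raddf0 P) subrr.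
  + move=> i; rewrite [LHS]/= Pu; case: (A i); last first.
      by rewrite (raddf0 D) (raddf0 P) subrr.
    by rewrite Du Pu; case: (A (s i)); rewrite ?subrr ?subr0.
  + by move=> m jm; exists (true, m, -1); rewrite //= jm.
  + move=> [[[] m] z]; rewrite /A /s /strand_shift /=; last lia.
    case: (boolP (below j m)) => jm; last by rewrite !andbF.
    by rewrite !andbT => zA; exists m => //; have -> : z = -1 by lia.
- have [_ [S [_ DS _]]] := D_normal; have [_ _ PP] := P_proj.
  pose T : {linear H -> H} := P \o D \o (idfun \- P).
  pose T' : {linear H -> H} := (idfun \- P) \o S \o P.
  apply: (rank_partial_isometry _ _ dot _ u (u \o s) T T'
    (fun i => ~~ A i && A (s i)) k (fun m => u (false, m, 0))).
  + by move=> x y; rewrite /= PP DS linearBl raddfB /= PP.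
  + by move=> m n; rewrite u_on !xpair_eqE eqxx andbT.
  + by move=> z zu; rewrite /= (Pker z) // subr0 (Dker z) // (raddf0 P).
  + move=> i; rewrite [LHS]/= Pu; case: (A i).
      by rewrite subrr (raddf0 D) (raddf0 P).
    by rewrite subr0 Du Pu.
  + by move=> m km; exists (false, m, -1).
  + move=> [[[] m] z]; rewrite /A /s /strand_shift /=; first lia.
    case: (boolP (below k m)) => km; last by rewrite !andbF.
    by rewrite !andbT => zA; exists m => //; have -> : z = -1 by lia.
Qed.
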